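(* Let $\tau\in\mathbb{C}$ be arbitrary, let $\mathcal{A}_\tau=\{z\in\mathbb{C}: z^2=\tau\}$, and define $$\mathbf{a}_\tau=-\tfrac14\big(1+\tau e^{\frac{7\pi}{4}i}\big),\quad \mathbf{b}_\tau=\tfrac14\big(3-\tau e^{\frac{7\pi}{4}i}\big),\quad \mathbf{c}_\tau=\tfrac14\big(1-\tau e^{\frac{7\pi}{4}i}\big),\quad \mathbf{d}_\tau=\tfrac14\big(5-\tau e^{\frac{7\pi}{4}i}\big).$$ Then every solution $X:\mathbb{C}\setminus\mathcal{A}_\tau\to\mathbb{C}$ of the complex ordinary differential equation $$i(\tau-z^2)X''(z)-6i\,z\,X'(z)+\big((\tau-z^2)^2-6i\big)X(z)=0,\qquad z\in\mathbb{C}\setminus\mathcal{A}_\tau,$$ can be written as $X(z)=c_1X_{\tau,1}(z)+c_2X_{\tau,2}(z)$, where $c_1,c_2\in\mathbb{C}$ are arbitrary constants and the functions $X_{\tau,1},X_{\tau,2}$ are meromorphic and defined by $$X_{\tau,1}(z)=\frac{\exp\big(\frac12e^{\frac{3\pi}{4}i}z^2\big)}{(\tau-z^2)^2}\Big[\tau\,\mathcal{M}\big(\mathbf{a}_\tau,\tfrac12,e^{\frac{7\pi}{4}i}z^2\big)-4\mathbf{a}_\tau z^2\,\mathcal{M}\big(\mathbf{b}_\tau,\tfrac32,e^{\frac{7\pi}{4}i}z^2\big)\Big],$$ $$X_{\tau,2}(z)=z\,\frac{\exp\big(\frac12e^{\frac{3\pi}{4}i}z^2\big)}{(\tau-z^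2)^2}\Big[\mathcal{M}\big(\mathbf{c}_\tau,\tfrac32,e^{\frac{7\pi}{4}i}z^2\big)+e^{\frac{7\pi}{4}i}\frac{z^2}{3}\,\mathcal{M}\big(\mathbf{d}_\tau,\tfrac52,e^{\frac{7\pi}{4}i}z^2\big)\Big].$$
   Context: $\mathcal{M}$ denotes Kummer's confluent hypergeometric function of the first kind, $\mathcal{M}(\mathrm{a},\mathrm{c},\zeta)=\sum_{n=0}^\infty\frac{(\mathrm{a})_n}{(\mathrm{c})_n}\frac{\zeta^n}{n!}$ for $\zeta,\mathrm{a}\in\mathbb{C}$, $\mathrm{c}\in\mathbb{C}\setminus\{0,-1,-2,\dots\}$, where $(\mathrm{a})_n=\mathrm{a}(\mathrm{a}+1)\cdots(\mathrm{a}+n-1)$, $(\mathrm{a})_0=1$, is the Pochhammer symbol. Solutions are understood in the complex-differentiable sense. *)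

(* Defs.v *)
From Stdlib Require Import Reals Factorial.
From Coquelicot Require Import Coquelicot.

Open Scope C_scope.

Definition Cexp (z : C) : C :=
  RtoC (exp (Re z)) * (RtoC (cos (Im z)) + Ci * RtoC (sin (Im z))).

(* Sum of a complex series, componentwise; it is the sum in the sense of
   [is_series] whenever the series converges (see [CSeries_unique]). *)
Definition CSeries (u : nat -> C) : C :=
  (Series (fun n => Re (u n)), Series (fun n => Im (u n))).

Lemma CSeries_unique (u : nat -> C) (l : C) :
  @is_series C_AbsRing C_NormedModule u l -> CSeries u = l.
Proof.
  intros H.
  assert (E : forall n,
    sum_n (G := C_AbelianMonoid) u n
    = (sum_n (fun k => Re (u k)) n, sum_n (fun k => Im (u k)) n)).
  { induction n as [|n IH].
    - rewrite !sum_O. now destruct (u 0%nat).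
    - rewrite !sum_Sn, IH. now destruct (u (S n)). }
  destruct l as [x y].
  unfold CSeries; f_equal; apply is_series_unique;
    apply filterlim_locally; intros eps;
    generalize (proj1 (filterlim_locally (U := C_UniformSpace) _ _) H eps);
    apply filter_imp; intros n Hn;
    change (@ball C_UniformSpace (x, y) eps
              (sum_n (G := C_AbelianMonoid) u n)) in Hn;
    rewrite E in Hn; apply Hn.
Qed.

Fixpoint pochhammer (a : C) (n : nat) : C :=
  match n with
  | O => 1
  | S m => pochhammer a m * (a + RtoC (INR m))
  end.

(* The values are meaningful only when [c] is not in {0, -1, -2, ...}. *)
Definition kummerM (a c zeta : C) : C :=
  CSeries (fun n =>
    pochhammer a n / pochhammer c n * (zeta ^ n / RtoC (INR (fact n)))).

Definition Cdifferentiable (f : C -> C) (z : C) : Prop :=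
  @ex_derive C_AbsRing C_NormedModule f z.

(* [f] is meromorphic on C with all its poles in [S]: [S] consists of isolated
   points and has no accumulation point, [f] is holomorphic off [S], and every
   point [p] of [S] is a pole of [f] or a removable singularity, i.e.
   (z - p)^n f(z) extends holomorphically across [p] for some [n].
   The values of the total function [f] on [S] are irrelevant. *)
Definition meromorphic_off (S : C -> Prop) (f : C -> C) : Prop :=
  (forall p : C, @locally' C_UniformSpace p (fun z => ~ S z)) /\
  (forall z : C, ~ S z -> Cdifferentiable f z) /\
  (forall p : C, S p ->
     exists (n : nat) (g : C -> C),
       @locally C_UniformSpace p (Cdifferentiable g) /\
       @locally' C_UniformSpace p (fun z => (z - p) ^ n * f z = g z)).

Definition A (tau z : C) : Prop := z ^ 2 = tau.

(* The open set on which the equation holds is the complement of the closed set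
   [A tau], so the values on [A tau] of the total function [X] do not matter.
   [C_derive] is the complex derivative only where it exists, hence the two
   differentiability requirements. *)
Definition is_solution (tau : C) (X : C -> C) : Prop :=
  forall z : C, ~ A tau z ->
    Cdifferentiable X z /\
    Cdifferentiable (C_derive X) z /\
    Ci * (tau - z ^ 2) * C_derive (C_derive X) z
      - 6 * Ci * z * C_derive X z
      + ((tau - z ^ 2) ^ 2 - 6 * Ci) * X z = 0.

Definition e3 : C := Cexp (RtoC (3 * PI / 4) * Ci).
Definition e7 : C := Cexp (RtoC (7 * PI / 4) * Ci).

Definition a_ (tau : C) : C := - (1 / 4) * (1 + tau * e7).
Definition b_ (tau : C) : C := 1 / 4 * (3 - tau * e7).
Definition c_ (tau : C) : C := 1 / 4 * (1 - tau * e7).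
Definition d_ (tau : C) : C := 1 / 4 * (5 - tau * e7).

Definition X1 (tau z : C) : C :=
  Cexp (1 / 2 * e3 * z ^ 2) / (tau - z ^ 2) ^ 2 *
  (tau * kummerM (a_ tau) (1 / 2) (e7 * z ^ 2)
   - 4 * a_ tau * z ^ 2 * kummerM (b_ tau) (3 / 2) (e7 * z ^ 2)).

Definition X2 (tau z : C) : C :=
  z * (Cexp (1 / 2 * e3 * z ^ 2) / (tau - z ^ 2) ^ 2) *
  (kummerM (c_ tau) (3 / 2) (e7 * z ^ 2)
   + e7 * (z ^ 2 / 3) * kummerM (d_ tau) (5 / 2) (e7 * z ^ 2)).

(* Main.v *)
Require Import Defs.
From Stdlib Require Import Reals.
From Coquelicot Require Import Coquelicot.
From Stdlib Require Import Factorial Lra Classical.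
Open Scope C_scope.

(* Writing [X = N / (tau - z^2)^2] turns the equation into
   [i ((tau - z^2) N'' + 2 z N' - 2 N) + (tau - z^2)^2 N = 0], whose solutions are
   images of the solutions [w] of a Weber equation under the first-order map
   [N = (tau - z^2) w - z w' / e7] (up to a constant, for the odd solution). The
   contiguous relations of Kummer's function express [N1], [N2] and their
   derivatives as polynomial combinations of two Kummer functions, which also
   covers the degenerate values of [tau] where that map kills [w].
   Kummer's Wronskian gives [N1 N2' - N1' N2 = tau - z^2], so that
   [(tau - z^2)^3 W(X1, X2) = 1]; since [(tau - z^2)^3 W] of any two solutions
   is constant on the connected set [C \ A tau], Cramer's rule recovers the
   coefficients of an arbitrary solution. *)

(** * Complex differentiation *)

Lemma Cmod_le_components (z : C) : (Cmod z <= Rabs (Re z) + Rabs (Im z))%R.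
Proof.
  destruct z as [x y]. unfold Re, Im; simpl.
  replace (x, y) with (x + Ci * y).
  - eapply Rle_trans; [apply Cmod_triangle|].
    rewrite Cmod_mult, Cmod_Ci, !Cmod_R. lra.
  - unfold Cplus, Cmult, Ci, RtoC; simpl. f_equal; ring.
Qed.

Definition is_Cderive (f : C -> C) (z l : C) : Prop :=
  @is_derive C_AbsRing C_NormedModule f z l.

(** Both module structures on C carry the norm [Cmod], so their conditions on the remainder agree.
    The product rule and the inner function of the chain rule use the ring as a module over
    itself. *)
Lemma is_Cderive_AbsRing (f : C -> C) (z l : C) :
  is_Cderive f z l <-> @is_derive C_AbsRing (AbsRing_NormedModule C_AbsRing) f z l.
Proof.
  split; intros [_ H]; (split; [apply is_linear_scal_l|exact H]).
Qed.

Lemma is_Cderive_eps (f : C -> C) (z l : C) :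
  is_Cderive f z l <->
  forall eps : posreal, exists d : posreal, forall y : C, (Cmod (y - z) < d)%R ->
    (Cmod (f y - f z - (y - z) * l) <= eps * Cmod (y - z))%R.
Proof.
  split.
  - intros [_ H] eps.
    destruct (H z (fun P HP => HP) eps) as [d Hd].
    exists d; intros y Hy. exact (Hd y Hy).
  - intros H. split; [apply is_linear_scal_l|].
    intros x Hx eps.
    rewrite <- (is_filter_lim_locally_unique _ _ Hx).
    destruct (H eps) as [d Hd]. exists d. exact Hd.
Qed.

Lemma is_Cderive_const (k z : C) : is_Cderive (fun _ => k) z 0.
Proof. exact (@is_derive_const C_AbsRing C_NormedModule k z). Qed.
Lemma is_Cderive_id (z : C) : is_Cderive (fun y => y) z 1.
Proof. apply is_Cderive_AbsRing. exact (@is_derive_id C_AbsRing z). Qed.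
Lemma is_Cderive_plus (f g : C -> C) (z df dg : C) :
  is_Cderive f z df -> is_Cderive g z dg -> is_Cderive (fun y => f y + g y) z (df + dg).
Proof. exact (@is_derive_plus C_AbsRing C_NormedModule f g z df dg). Qed.
Lemma is_Cderive_minus (f g : C -> C) (z df dg : C) :
  is_Cderive f z df -> is_Cderive g z dg -> is_Cderive (fun y => f y - g y) z (df - dg).
Proof. exact (@is_derive_minus C_AbsRing C_NormedModule f g z df dg). Qed.
Lemma is_Cderive_mult (f g : C -> C) (z df dg : C) :
  is_Cderive f z df -> is_Cderive g z dg ->
  is_Cderive (fun y => f y * g y) z (df * g z + f z * dg).
Proof.
  rewrite !is_Cderive_AbsRing. intros Hf Hg.
  apply (@is_derive_mult C_AbsRing f g z df dg Hf Hg). exact Cmult_comm.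
Qed.
Lemma is_Cderive_comp (f g : C -> C) (z df dg : C) :
  is_Cderive f (g z) df -> is_Cderive g z dg ->
  is_Cderive (fun y => f (g y)) z (dg * df).
Proof.
  rewrite (is_Cderive_AbsRing g). intros Hf Hg.
  exact (@is_derive_comp C_AbsRing C_NormedModule f g z df dg Hf Hg).
Qed.
Lemma is_Cderive_inv (z : C) : z <> 0 -> is_Cderive (fun y => / y) z (- / (z * z)).
Proof.
  intros Hz. apply is_Cderive_eps. intros eps.
  assert (Hm : (0 < Cmod z)%R) by (now apply Cmod_gt_0).
  set (m := Cmod z) in *.
  (* The remainder is (y - z)^2 / (y z^2). The first bound gives |y| > m / 2, and the second then
     makes |y - z| / (|y| m^2) at most eps. *)
  assert (Hd : (0 < Rmin (m / 2) (eps * (m * m * m) / 2))%R).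
  { apply Rmin_pos; [lra|]. pose proof (cond_pos eps).
    assert (0 < m * m * m)%R by (repeat apply Rmult_lt_0_compat; lra). nra. }
  exists (mkposreal _ Hd). simpl. intros y Hy.
  pose proof (Rlt_le_trans _ _ _ Hy (Rmin_l _ _)) as H1.
  pose proof (Rlt_le_trans _ _ _ Hy (Rmin_r _ _)) as H2.
  assert (Hy2 : (m / 2 < Cmod y)%R).
  { pose proof (Cmod_triangle y (z - y)) as T.
    replace (y + (z - y)) with z in T by ring.
    replace (z - y) with (- (y - z)) in T by ring. rewrite Cmod_opp in T.
    fold m in T. lra. }
  assert (Hy0 : y <> 0). { apply Cmod_gt_0. lra. }
  replace (/ y - / z - (y - z) * - / (z * z)) with ((y - z) * ((y - z) / (y * z * z)))
    by (field; auto).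
  rewrite Cmod_mult, Cmod_div by (repeat apply Cmult_neq_0; auto).
  rewrite !Cmod_mult. fold m.
  rewrite (Rmult_comm eps). apply Rmult_le_compat_l; [apply Cmod_ge_0|].
  assert (0 < m / 2 * m * m)%R by (repeat apply Rmult_lt_0_compat; lra).
  assert (m / 2 * m * m <= Cmod y * m * m)%R.
  { repeat apply Rmult_le_compat_r; lra. }
  apply Rmult_le_reg_r with (Cmod y * m * m)%R; [lra|].
  unfold Rdiv at 1. rewrite Rmult_assoc, Rinv_l, Rmult_1_r by lra.
  pose proof (cond_pos eps). nra.
Qed.

(** Balls of [C_UniformSpace] are squares: a disc of radius d lies in the square of half-side d and
    contains the square of half-side d / sqrt 2. *)
Lemma locally_Cmod (z : C) (P : C -> Prop) :
  @locally C_UniformSpace z P <->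
  exists d : posreal, forall y : C, (Cmod (y - z) < d)%R -> P y.
Proof.
  split; intros [d Hd].
  - exists d. intros y Hy. apply Hd.
    pose proof (Rmax_Cmod (y - z)) as M.
    split; (eapply Rle_lt_trans; [|exact Hy]); (eapply Rle_trans; [|exact M]).
    + apply Rmax_l.
    + apply Rmax_r.
  - assert (Hs : (0 < sqrt 2)%R) by (apply sqrt_lt_R0; lra).
    exists (mkposreal _ (Rdiv_lt_0_compat _ _ (cond_pos d) Hs)).
    intros y Hy. apply Hd.
    pose proof (C_NormedModule_mixin_compat2 z y _ Hy) as H. simpl in H.
    replace (sqrt 2 * (d / sqrt 2))%R with (d : R) in H by (field; lra).
    exact H.
Qed.

Lemma is_Cderive_ext_loc (f g : C -> C) (z l : C) :
  @locally C_UniformSpace z (fun y => f y = g y) ->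
  is_Cderive f z l -> is_Cderive g z l.
Proof.
  intros HE. apply locally_Cmod in HE. destruct HE as [d Hd].
  rewrite !is_Cderive_eps. intros H eps.
  destruct (H eps) as [e He].
  exists (mkposreal _ (Rmin_pos _ _ (cond_pos d) (cond_pos e))).
  simpl. intros y Hy.
  rewrite <- !Hd.
  - apply He. eapply Rlt_le_trans; [exact Hy|apply Rmin_r].
  - replace (z - z) with (RtoC 0) by ring. rewrite Cmod_0. apply cond_pos.
  - eapply Rlt_le_trans; [exact Hy|apply Rmin_l].
Qed.

Lemma is_Cderive_ext (f g : C -> C) (z l : C) :
  (forall y, f y = g y) -> is_Cderive f z l -> is_Cderive g z l.
Proof.
  intros H. apply is_Cderive_ext_loc, locally_Cmod.
  exists (mkposreal 1 Rlt_0_1). auto.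
Qed.

Lemma is_Cderive_eq (f : C -> C) (z l m : C) :
  is_Cderive f z l -> l = m -> is_Cderive f z m.
Proof. now intros H <-. Qed.

Lemma C_derive_eq (f : C -> C) (z l : C) : is_Cderive f z l -> C_derive f z = l.
Proof. exact (is_C_derive_unique f z l). Qed.

Lemma C_derive_is_Cderive (f : C -> C) (z : C) :
  Cdifferentiable f z -> is_Cderive f z (C_derive f z).
Proof. exact (C_derive_correct f z z). Qed.

Lemma is_Cderive_Cdifferentiable (f : C -> C) (z l : C) :
  is_Cderive f z l -> Cdifferentiable f z.
Proof. intros H. exists l. exact H. Qed.

Lemma is_Cderive_continuous (f : C -> C) (z l : C) (eps : posreal) :
  is_Cderive f z l -> @locally C_UniformSpace z (fun y => (Cmod (f y - f z) < eps)%R).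
Proof.
  rewrite is_Cderive_eps. intros H.
  destruct (H (mkposreal 1 Rlt_0_1)) as [d Hd]. simpl in Hd.
  pose proof (Cmod_ge_0 l) as Hl.
  (* With an error of at most |y - z|, the increment of f is at most (|l| + 1) |y - z|. *)
  assert (He : (0 < eps / (Cmod l + 2))%R).
  { apply Rdiv_lt_0_compat; [apply cond_pos|lra]. }
  apply locally_Cmod.
  exists (mkposreal _ (Rmin_pos _ _ (cond_pos d) He)). simpl. intros y Hy.
  pose proof (Rlt_le_trans _ _ _ Hy (Rmin_l _ _)) as H1.
  pose proof (Rlt_le_trans _ _ _ Hy (Rmin_r _ _)) as H2.
  specialize (Hd y H1).
  pose proof (Cmod_triangle (f y - f z - (y - z) * l) ((y - z) * l)) as T.
  replace (f y - f z - (y - z) * l + (y - z) * l) with (f y - f z) in T by ring.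
  rewrite (Cmod_mult (y - z)) in T.
  apply (Rmult_lt_compat_r (Cmod l + 2)) in H2; [|lra].
  replace (eps / (Cmod l + 2) * (Cmod l + 2))%R with (eps : R) in H2 by (field; lra).
  pose proof (Cmod_ge_0 (y - z)). nra.
Qed.

(** * Functions with zero derivative *)

Lemma is_Cderive_RtoC_path (f : C -> C) (p v : C) (t : R) :
  is_Cderive f (p + t * v) 0 ->
  @is_derive R_AbsRing C_R_NormedModule (fun u : R => f (p + u * v)) t zero.
Proof.
  rewrite is_Cderive_eps. intros H.
  split; [apply is_linear_scal_l|].
  intros x Hx eps. rewrite <- (is_filter_lim_locally_unique _ _ Hx).
  pose proof (Cmod_ge_0 v) as Hv.
  (* The line is traversed at speed |v|; |v| + 1 stands in the denominators because v may be 0. *)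
  assert (Hv1 : (0 < Cmod v + 1)%R) by lra.
  destruct (H (mkposreal _ (Rdiv_lt_0_compat _ _ (cond_pos eps) Hv1))) as [d Hd].
  exists (mkposreal _ (Rdiv_lt_0_compat _ _ (cond_pos d) Hv1)).
  intros u Hu. change (Rabs (u - t) < d / (Cmod v + 1))%R in Hu.
  rewrite (@scal_zero_r R_AbsRing C_R_NormedModule).
  replace (norm (K := R_AbsRing) _) with (Cmod (f (p + u * v)%C - f (p + t * v)%C - 0))
    by apply Cmod_norm.
  change (norm (minus u t)) with (Rabs (u - t)).
  assert (E : Cmod (p + u * v - (p + t * v)) = (Rabs (u - t) * Cmod v)%R).
  { rewrite <- Cmod_R, <- Cmod_mult. f_equal. rewrite RtoC_minus. ring. }
  pose proof (Rabs_pos (u - t)) as Hp.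
  assert (Hl : (Rabs (u - t) * Cmod v < d)%R).
  { apply (Rmult_lt_compat_r (Cmod v + 1)) in Hu; [|lra].
    replace (d / (Cmod v + 1) * (Cmod v + 1))%R with (d : R) in Hu by (field; lra).
    nra. }
  specialize (Hd (p + u * v)). rewrite E in Hd. specialize (Hd Hl). simpl in Hd.
  replace ((p + u * v - (p + t * v)) * 0) with (RtoC 0) in Hd by ring.
  eapply Rle_trans; [exact Hd|].
  unfold Rdiv. rewrite Rmult_assoc. apply Rmult_le_compat_l; [apply Rlt_le, cond_pos|].
  apply Rmult_le_reg_l with (Cmod v + 1)%R; [lra|].
  replace ((Cmod v + 1) * (/ (Cmod v + 1) * (Rabs (u - t) * Cmod v)))%R
    with (Rabs (u - t) * Cmod v)%R by (field; lra).
  nra.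
Qed.

(** The restriction to the segment is a function of a real variable with zero derivative on
    [0, 1]. *)
Lemma zero_Cderive_segment (f : C -> C) (p q : C) :
  (forall t : R, (0 <= t <= 1)%R -> is_Cderive f (p + t * (q - p)) 0) -> f p = f q.
Proof.
  intros H.
  pose proof (@eq_is_derive C_R_NormedModule (fun u : R => f (p + u * (q - p))) 0 1) as E.
  cbv beta in E.
  replace (p + 0 * (q - p)) with p in E by ring.
  replace (p + 1 * (q - p)) with q in E by ring.
  apply E; [|lra]. intros t Ht. apply is_Cderive_RtoC_path. auto.
Qed.

(* A punctured plane is connected by two-segment paths: through a corner
   [t + i Y] with [Y] off the heights of [p] and [q], each puncture blocks
   at most one [t] on either segment. *)
Lemma zero_Cderive_const (f : C -> C) (s1 s2 : C) :
  (forall z, z <> s1 -> z <> s2 -> is_Cderive f z 0) ->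
  forall p q, p <> s1 -> p <> s2 -> q <> s1 -> q <> s2 -> f p = f q.
Proof.
  intros H p q Hp1 Hp2 Hq1 Hq2.
  set (Y := (1 + Rabs (Im p) + Rabs (Im q))%R).
  (* [v r s] is the abscissa t for which the line from r to t + i Y passes through s. For
     [Im s = Im r] it is a default value, and the segment meets that height only at r. *)
  pose (v := fun r s : C => (Re r + (Re s - Re r) * (Y - Im r) / (Im s - Im r))%R).
  (* Larger than all four forbidden abscissas. *)
  set (t := (1 + Rabs (v p s1) + Rabs (v p s2) + Rabs (v q s1) + Rabs (v q s2))%R).
  assert (B : forall r s : C, r <> s -> (Im r < Y)%R -> (t <> v r s) ->
    forall u : R, r + u * ((t, Y) - r) <> s).
  { intros r s Hrs HY Ht u E.
    assert (E1 : (Re r + u * (t - Re r) = Re s)%R).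
    { rewrite <- E. destruct r. unfold Re; simpl. ring. }
    assert (E2 : (Im r + u * (Y - Im r) = Im s)%R).
    { rewrite <- E. destruct r. unfold Im; simpl. ring. }
    assert (Hu : u <> 0%R).
    { intros ->. apply Hrs. rewrite <- E. ring. }
    apply Ht. unfold v. rewrite <- E1, <- E2. field. nra. }
  assert (Hv : t <> v p s1 /\ t <> v p s2 /\ t <> v q s1 /\ t <> v q s2).
  { unfold t. generalize (v p s1) (v p s2) (v q s1) (v q s2). intros x1 x2 x3 x4.
    pose proof (Rle_abs x1). pose proof (Rle_abs x2).
    pose proof (Rle_abs x3). pose proof (Rle_abs x4).
    pose proof (Rabs_pos x1). pose proof (Rabs_pos x2).
    pose proof (Rabs_pos x3). pose proof (Rabs_pos x4).
    repeat split; lra. }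
  assert (HY : (Im p < Y)%R /\ (Im q < Y)%R).
  { unfold Y. pose proof (Rle_abs (Im p)). pose proof (Rle_abs (Im q)).
    pose proof (Rabs_pos (Im p)). pose proof (Rabs_pos (Im q)). lra. }
  transitivity (f (t, Y)); [|symmetry]; apply zero_Cderive_segment;
    intros u _; apply H; apply B; tauto.
Qed.

(* Otherwise unification in [Cder] below unfolds it down to filters. *)
Opaque is_Cderive.

(** * Power series and Kummer's function *)

Definition is_Cseries (u : nat -> C) (l : C) : Prop :=
  @is_series C_AbsRing C_NormedModule u l.

Definition entire_coeffs (a : nat -> C) : Prop :=
  forall r : R, (0 <= r)%R -> ex_series (fun n => Cmod (a n) * r ^ n)%R.

Definition CPSeries (a : nat -> C) (z : C) : C := CSeries (fun n => a n * z ^ n).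

Definition CPS_derive (a : nat -> C) (n : nat) : C := INR (S n) * a (S n).

(** A zero in front encodes multiplication of a power series by z, and also n z^(n-1) with the value
    0 at n = 0. *)
Definition shift (u : nat -> C) (n : nat) : C :=
  match n with O => 0 | S m => u m end.

Lemma is_Cseries_ext (u v : nat -> C) (l : C) :
  (forall n, u n = v n) -> is_Cseries u l -> is_Cseries v l.
Proof. apply is_series_ext. Qed.

Lemma is_Cseries_plus (u v : nat -> C) (l m : C) :
  is_Cseries u l -> is_Cseries v m -> is_Cseries (fun n => u n + v n) (l + m).
Proof. exact (@is_series_plus C_AbsRing C_NormedModule u v l m). Qed.

Lemma is_Cseries_scal (k : C) (u : nat -> C) (l : C) :
  is_Cseries u l -> is_Cseries (fun n => k * u n) (k * l).
Proof. exact (@is_series_scal C_AbsRing C_NormedModule k u l). Qed.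

Lemma is_Cseries_decr_1 (u : nat -> C) (l : C) :
  is_Cseries (fun n => u (S n)) l -> is_Cseries u (l + u O).
Proof.
  intros H. apply (@is_series_decr_1 C_AbsRing C_NormedModule).
  replace (@plus (NormedModule.AbelianMonoid _ C_NormedModule) _ _) with l; [exact H|].
  change (l = l + u O + - u O). ring.
Qed.

Lemma is_Cseries_shift (u : nat -> C) (l : C) :
  is_Cseries u l -> is_Cseries (shift u) l.
Proof.
  intros H. replace l with (l + shift u O) by (simpl; ring).
  now apply is_Cseries_decr_1.
Qed.

Lemma is_Cseries_unique (u : nat -> C) (l m : C) :
  is_Cseries u l -> is_Cseries u m -> l = m.
Proof.
  intros Hl Hm. now rewrite <- (CSeries_unique u l Hl), <- (CSeries_unique u m Hm).
Qed.

(** The real and imaginary parts are each bounded by the sum of b, which gives the factor 2. *)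
Lemma Cmod_Cseries_le (u : nat -> C) (b : nat -> R) (l : C) :
  (forall n, (Cmod (u n) <= b n)%R) -> ex_series b -> is_Cseries u l ->
  (Cmod l <= 2 * Series b)%R.
Proof.
  intros Hu Hb Hl. rewrite <- (CSeries_unique u l Hl).
  assert (B : forall f : C -> R, (forall x, (Rabs (f x) <= Cmod x)%R) ->
    (Rabs (Series (fun n => f (u n))) <= Series b)%R).
  { intros f Hf.
    assert (H : forall n, (0 <= Rabs (f (u n)) <= b n)%R).
    { intros n. split; [apply Rabs_pos|]. eapply Rle_trans; [apply Hf|apply Hu]. }
    eapply Rle_trans; [apply Series_Rabs|apply Series_le; auto].
    apply (@ex_series_le R_AbsRing R_CompleteNormedModule _ b); auto.
    intros n. change (Rabs (Rabs (f (u n))) <= b n)%R. rewrite Rabs_Rabsolu. apply H. }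
  set (x := CSeries u).
  pose proof (Cmod_le_components x) as T.
  pose proof (B fst (fun x => Rle_trans _ _ _ (Rmax_l _ _) (Rmax_Cmod x))).
  pose proof (B snd (fun x => Rle_trans _ _ _ (Rmax_r _ _) (Rmax_Cmod x))).
  unfold x, CSeries in *. unfold Re at 1, Im at 1 in T. simpl in T.
  change (Series (fun n => Re (u n))) with (Series (fun n => fst (u n))) in *.
  change (Series (fun n => Im (u n))) with (Series (fun n => snd (u n))) in *.
  lra.
Qed.

Lemma CPSeries_is_series (a : nat -> C) (z : C) :
  entire_coeffs a -> is_Cseries (fun n => a n * z ^ n) (CPSeries a z).
Proof.
  intros H.
  destruct (@ex_series_le C_AbsRing C_CompleteNormedModule (fun n => a n * z ^ n)
    (fun n => (Cmod (a n) * Cmod z ^ n)%R)) as [l Hl].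
  - intros n. change (Cmod (a n * z ^ n) <= Cmod (a n) * Cmod z ^ n)%R.
    rewrite Cmod_mult, Cmod_pow. apply Rle_refl.
  - apply H, Cmod_ge_0.
  - unfold CPSeries. rewrite (CSeries_unique _ l Hl). exact Hl.
Qed.

(** * Termwise differentiation of power series *)

Lemma INR_le_pow2 (n : nat) : (INR n <= 2 ^ n)%R.
Proof.
  induction n as [|n IH]; [simpl; lra|].
  rewrite S_INR. simpl. pose proof (pow_R1_Rle 2 n ltac:(lra)). lra.
Qed.

(** The factor n + 1 is absorbed by 2^(n+1), so the series of a at radius [2 * (r + 1)]
    dominates. *)
Lemma entire_coeffs_derive (a : nat -> C) :
  entire_coeffs a -> entire_coeffs (CPS_derive a).
Proof.
  intros H r Hr.
  apply (@ex_series_le R_AbsRing R_CompleteNormedModule _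
    (fun n => Cmod (a (S n)) * (2 * (r + 1)) ^ S n)%R).
  - intros n.
    change (Rabs (Cmod (CPS_derive a n) * r ^ n)
      <= Cmod (a (S n)) * (2 * (r + 1)) ^ S n)%R.
    unfold CPS_derive. rewrite Cmod_mult, Cmod_R, Rpow_mult_distr.
    pose proof (Cmod_ge_0 (a (S n))) as Ha.
    pose proof (pos_INR (S n)) as Hn.
    pose proof (pow_le r n Hr) as Hrn.
    rewrite (Rabs_pos_eq (INR (S n))) by auto.
    rewrite Rabs_pos_eq by (repeat apply Rmult_le_pos; auto).
    replace (INR (S n) * Cmod (a (S n)) * r ^ n)%R
      with (Cmod (a (S n)) * (INR (S n) * r ^ n))%R by ring.
    apply Rmult_le_compat_l; auto.
    apply Rmult_le_compat; auto; [apply INR_le_pow2|].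
    apply Rle_trans with ((r + 1) ^ n)%R; [apply pow_incr; lra|].
    simpl. pose proof (pow_le (r + 1) n ltac:(lra)). nra.
  - apply (ex_series_incr_1 (fun n => Cmod (a n) * (2 * (r + 1)) ^ n)%R).
    apply H. lra.
Qed.

(** Remainder of the first-order Taylor expansion of y^n at z. *)
Definition pow_error (z y : C) (n : nat) : C :=
  y ^ n - z ^ n - (y - z) * shift (fun m => INR (S m) * z ^ m) n.

(** Induction on e_(n+1) = y e_n + (y - z)^2 n z^(n-1), where e_n is the error. With r >= 1, the
    power r^(n-1) may be replaced by r^n. *)
Lemma Cmod_pow_error_le (z y : C) (r : R) (n : nat) :
  (1 <= r)%R -> (Cmod z <= r)%R -> (Cmod y <= r)%R ->
  (Cmod (pow_error z y n) <= INR n * INR n * r ^ n * (Cmod (y - z)) ^ 2)%R.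
Proof.
  intros Hr Hz Hy.
  pose proof (Cmod_ge_0 (y - z)) as Hd.
  induction n as [|n IH].
  - unfold pow_error. replace (_ - _) with (RtoC 0) by (simpl; ring).
    rewrite Cmod_0. simpl. lra.
  - assert (E : pow_error z y (S n) =
      y * pow_error z y n + (y - z) ^ 2 * shift (fun m => INR (S m) * z ^ m) n).
    { unfold pow_error. destruct n as [|n].
      - simpl. ring.
      - unfold shift. rewrite (S_INR (S n)), RtoC_plus. simpl Cpow. ring. }
    assert (B : (Cmod (shift (fun m => INR (S m) * z ^ m)%C n) <= INR n * r ^ n)%R).
    { destruct n as [|n]; [simpl; rewrite Cmod_0; lra|]. unfold shift.
      rewrite Cmod_mult, Cmod_R, Cmod_pow, Rabs_pos_eq by apply pos_INR.
      apply Rmult_le_compat_l; [apply pos_INR|].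
      apply Rle_trans with (r ^ n)%R; [apply pow_incr; split; auto; apply Cmod_ge_0|].
      simpl. pose proof (pow_le r n ltac:(lra)). nra. }
    rewrite E. eapply Rle_trans; [apply Cmod_triangle|].
    rewrite !Cmod_mult, Cmod_pow.
    set (d := (Cmod (y - z) ^ 2)%R) in *.
    assert (Hd2 : (0 <= d)%R) by (apply pow_le; auto).
    pose proof (pow_le r n ltac:(lra)) as Hrn. pose proof (pos_INR n) as Hn.
    pose proof (Cmod_ge_0 (pow_error z y n)).
    rewrite S_INR. simpl pow.
    apply Rle_trans with (r * (INR n * INR n * r ^ n * d) + d * (INR n * r ^ n))%R.
    + apply Rplus_le_compat; [|apply Rmult_le_compat_l; auto].
      apply Rmult_le_compat; auto. apply Cmod_ge_0.
    + assert (0 <= r ^ n * d)%R by (apply Rmult_le_pos; auto).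
      replace (r * (INR n * INR n * r ^ n * d) + d * (INR n * r ^ n))%R
        with ((r * (INR n * INR n) + INR n) * (r ^ n * d))%R by ring.
      replace ((INR n + 1) * (INR n + 1) * (r * r ^ n) * d)%R
        with ((INR n + 1) * (INR n + 1) * r * (r ^ n * d))%R by ring.
      apply Rmult_le_compat_r; auto. nra.
Qed.

(** The remainder is the sum of the a n times [pow_error z y n], hence O(|y - z|^2) on the unit disc
    around z. *)
Lemma is_Cderive_CPSeries (a : nat -> C) (z : C) :
  entire_coeffs a -> is_Cderive (CPSeries a) z (CPSeries (CPS_derive a) z).
Proof.
  intros Ha.
  set (r := (Cmod z + 1)%R).
  pose proof (Cmod_ge_0 z) as Hz.
  (* The factor 4^n absorbs the n^2 in the bound on the power errors. *)
  set (b := fun n => (Cmod (a n) * (4 * r) ^ n)%R).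
  assert (Hb : ex_series b) by (apply Ha; unfold r; lra).
  set (M := (2 * Series b)%R).
  assert (Key : forall y, (Cmod (y - z) <= 1)%R ->
    (Cmod (CPSeries a y - CPSeries a z - (y - z) * CPSeries (CPS_derive a) z)
      <= M * Cmod (y - z) ^ 2)%R).
  { intros y Hy. pose proof (Cmod_ge_0 (y - z)) as Hd.
    assert (Hyr : (Cmod y <= r)%R).
    { unfold r. replace y with (z + (y - z)) by ring.
      eapply Rle_trans; [apply Cmod_triangle|].
      replace (z + (y - z) - z) with (y - z) by ring. lra. }
    unfold M.
    replace (2 * Series b * Cmod (y - z) ^ 2)%R
      with (2 * Series (fun n => Cmod (y - z) ^ 2 * b n))%R
      by (rewrite Series_scal_l; ring).
    apply Cmod_Cseries_le with (u := fun n => a n * pow_error z y n).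
    - intros n. rewrite Cmod_mult. unfold b.
      replace (Cmod (y - z) ^ 2 * (Cmod (a n) * (4 * r) ^ n))%R
        with (Cmod (a n) * ((4 * r) ^ n * Cmod (y - z) ^ 2))%R by ring.
      apply Rmult_le_compat_l; [apply Cmod_ge_0|].
      eapply Rle_trans; [apply (Cmod_pow_error_le z y r n); unfold r in *; lra|].
      apply Rmult_le_compat_r; [apply pow_le; auto|].
      replace 4%R with (2 * 2)%R by ring. rewrite !Rpow_mult_distr.
      apply Rmult_le_compat_r; [apply pow_le; unfold r; lra|].
      apply Rmult_le_compat; try apply pos_INR; apply INR_le_pow2.
    - apply (ex_series_scal_l (K := R_AbsRing) (Cmod (y - z) ^ 2)%R b Hb).
    - pose proof (CPSeries_is_series a y Ha) as Sy.
      pose proof (CPSeries_is_series a z Ha) as Sz.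
      pose proof (CPSeries_is_series _ z (entire_coeffs_derive a Ha)) as Sd.
      apply is_Cseries_shift in Sd.
      apply (is_Cseries_scal (-1)) in Sz. apply (is_Cseries_scal (- (y - z))) in Sd.
      pose proof (is_Cseries_plus _ _ _ _ (is_Cseries_plus _ _ _ _ Sy Sz) Sd) as S.
      replace (_ - _ - _) with
        (CPSeries a y + -1 * CPSeries a z + - (y - z) * CPSeries (CPS_derive a) z)
        by ring.
      revert S. apply is_Cseries_ext. intros [|n]; unfold pow_error, shift, CPS_derive; ring. }
  (* At y = z + 1 the right-hand side of [Key] is M itself. *)
  assert (HM : (0 <= M)%R).
  { specialize (Key (z + 1)). replace (z + 1 - z) with (RtoC 1) in Key by ring.
    rewrite Cmod_1 in Key. specialize (Key (Rle_refl 1)).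
    eapply Rle_trans; [apply Cmod_ge_0|]. eapply Rle_trans; [exact Key|]. lra. }
  apply is_Cderive_eps. intros eps.
  assert (HM1 : (0 < M + 1)%R) by lra.
  exists (mkposreal _ (Rmin_pos _ _ Rlt_0_1 (Rdiv_lt_0_compat _ _ (cond_pos eps) HM1))).
  simpl. intros y Hy.
  pose proof (Rlt_le_trans _ _ _ Hy (Rmin_l _ _)) as H1.
  pose proof (Rlt_le_trans _ _ _ Hy (Rmin_r _ _)) as H2.
  eapply Rle_trans; [apply Key; lra|].
  apply (Rmult_lt_compat_r (M + 1)) in H2; [|lra].
  replace (eps / (M + 1) * (M + 1))%R with (eps : R) in H2 by (field; lra).
  pose proof (Cmod_ge_0 (y - z)). simpl pow. nra.
Qed.

(** * Coefficients, derivative and contiguous relation of Kummer's function *)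

Definition kummer_coeff (a c : C) (n : nat) : C :=
  pochhammer a n / pochhammer c n / INR (fact n).

Lemma INR_fact_C_neq_0 (n : nat) : RtoC (INR (fact n)) <> 0.
Proof. intros H. apply RtoC_inj in H. now apply (INR_fact_neq_0 n). Qed.

(** Every factor c + m has positive real part. The condition covers the parameters 1/2, 3/2 and 5/2
    and is stable under c -> c + 1. *)
Lemma pochhammer_neq_0 (c : C) (n : nat) : (0 < Re c)%R -> pochhammer c n <> 0.
Proof.
  intros Hc. induction n as [|n IH]; simpl.
  - intros H. apply RtoC_inj in H. lra.
  - apply Cmult_neq_0; auto. intros H. apply (f_equal Re) in H.
    pose proof (pos_INR n). unfold Re in *; simpl in H. lra.
Qed.

(** The definition splits off the last factor; shifting the parameter by 1 requires splitting off
    the first. *)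
Lemma pochhammer_S_l (a : C) (n : nat) : pochhammer a (S n) = a * pochhammer (a + 1) n.
Proof.
  induction n as [|n IH].
  - simpl. ring.
  - change (pochhammer a (S (S n))) with (pochhammer a (S n) * (a + INR (S n))).
    rewrite IH, S_INR, RtoC_plus. simpl. ring.
Qed.

Lemma kummerM_CPSeries (a c z : C) :
  (0 < Re c)%R -> kummerM a c z = CPSeries (kummer_coeff a c) z.
Proof.
  intros Hc.
  assert (E : forall n, pochhammer a n / pochhammer c n * (z ^ n / INR (fact n))
    = kummer_coeff a c n * z ^ n).
  { intros n. unfold kummer_coeff. field.
    auto using INR_fact_C_neq_0, pochhammer_neq_0. }
  unfold kummerM, CPSeries, CSeries.
  f_equal; apply Series_ext; intros n; now rewrite E.
Qed.

(** Each ratio |a + m| / |c + m| is at most (|a| + m) / (Re c + m), which is below (|a| + 1)(1 + 1 /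
    Re c) for every m. *)
Lemma Cmod_kummer_coeff_le (a c : C) (n : nat) : (0 < Re c)%R ->
  (Cmod (kummer_coeff a c n) <= ((Cmod a + 1) * (1 + / Re c)) ^ n / INR (fact n))%R.
Proof.
  intros Hc. unfold kummer_coeff.
  rewrite Cmod_div by apply INR_fact_C_neq_0.
  rewrite Cmod_R, (Rabs_pos_eq (INR _)) by apply pos_INR.
  apply Rmult_le_compat_r.
  { apply Rlt_le, Rinv_0_lt_compat, INR_fact_lt_0. }
  set (B := ((Cmod a + 1) * (1 + / Re c))%R).
  pose proof (Cmod_ge_0 a) as Ha.
  pose proof (Rinv_0_lt_compat _ Hc) as Hi.
  induction n as [|n IH].
  - simpl. replace (1 / 1) with (RtoC 1) by field. rewrite Cmod_1. lra.
  - pose proof (pochhammer_neq_0 c n Hc) as Hp.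
    pose proof (pochhammer_neq_0 c (S n) Hc) as Hp'. simpl in Hp'.
    assert (Hcn : c + INR n <> 0) by (intros E; apply Hp'; rewrite E; ring).
    simpl pochhammer.
    replace (pochhammer a n * (a + INR n) / (pochhammer c n * (c + INR n)))
      with ((a + INR n) / (c + INR n) * (pochhammer a n / pochhammer c n)) by (field; auto).
    rewrite Cmod_mult. simpl pow.
    apply Rmult_le_compat; auto using Cmod_ge_0.
    rewrite Cmod_div by auto.
    assert (H1 : (Re c + INR n <= Cmod (c + INR n))%R).
    { pose proof (re_le_Cmod (c + INR n)) as H.
      replace (Re (c + INR n)) with (Re c + INR n)%R in H by reflexivity.
      pose proof (Rle_abs (Re c + INR n)). lra. }
    assert (H2 : (Cmod (a + INR n) <= Cmod a + INR n)%R).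
    { eapply Rle_trans; [apply Cmod_triangle|].
      rewrite Cmod_R, Rabs_pos_eq by apply pos_INR. lra. }
    pose proof (pos_INR n) as Hn.
    apply Rmult_le_reg_r with (Cmod (c + INR n)); [lra|].
    unfold Rdiv. rewrite Rmult_assoc, Rinv_l, Rmult_1_r by lra.
    eapply Rle_trans; [exact H2|].
    apply Rle_trans with (B * (Re c + INR n))%R.
    + assert (E : (B * (Re c + INR n)
        = (Cmod a + 1) * (1 + Re c + INR n + INR n * / Re c))%R) by (unfold B; field; lra).
      rewrite E. assert (0 <= INR n * / Re c)%R by (apply Rmult_le_pos; lra). nra.
    + apply Rmult_le_compat_l; auto. unfold B. nra.
Qed.

(** Comparison with the exponential series at B r. *)
Lemma entire_kummer_coeff (a c : C) : (0 < Re c)%R -> entire_coeffs (kummer_coeff a c).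
Proof.
  intros Hc r Hr.
  set (B := ((Cmod a + 1) * (1 + / Re c))%R).
  apply (@ex_series_le R_AbsRing R_CompleteNormedModule _
    (fun n => / INR (fact n) * (B * r) ^ n)%R).
  - intros n. change (Rabs (Cmod (kummer_coeff a c n) * r ^ n)
      <= / INR (fact n) * (B * r) ^ n)%R.
    rewrite Rabs_pos_eq.
    + rewrite Rpow_mult_distr.
      replace (/ INR (fact n) * (B ^ n * r ^ n))%R
        with (B ^ n / INR (fact n) * r ^ n)%R by (field; apply INR_fact_neq_0).
      apply Rmult_le_compat_r; [now apply pow_le|now apply Cmod_kummer_coeff_le].
    + apply Rmult_le_pos; [apply Cmod_ge_0|now apply pow_le].
  - exists (exp (B * r)). pose proof (is_exp_Reals (B * r)) as H.
    apply is_pseries_R in H. exact H.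
Qed.

(** Coefficient form of M'(a, c) = (a / c) M(a + 1, c + 1). *)
Lemma kummer_coeff_S (a c : C) (n : nat) : (0 < Re c)%R ->
  INR (S n) * kummer_coeff a c (S n) = a / c * kummer_coeff (a + 1) (c + 1) n.
Proof.
  intros Hc. unfold kummer_coeff.
  assert (Hc1 : (0 < Re (c + 1))%R) by (unfold Re in *; simpl; lra).
  pose proof (pochhammer_neq_0 _ n Hc1) as Hp.
  pose proof (pochhammer_neq_0 _ 1 Hc) as Hc0. simpl in Hc0.
  rewrite !pochhammer_S_l, fact_simpl, mult_INR, RtoC_mult.
  field. repeat split; auto using INR_fact_C_neq_0.
  - intros E. apply Hc0. rewrite E. ring.
  - intros E. apply RtoC_inj in E. now apply (not_0_INR (S n)).
Qed.

Lemma is_Cderive_kummerM (a c z : C) : (0 < Re c)%R ->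
  is_Cderive (kummerM a c) z (a / c * kummerM (a + 1) (c + 1) z).
Proof.
  intros Hc.
  assert (Hc1 : (0 < Re (c + 1))%R) by (unfold Re in *; simpl; lra).
  apply is_Cderive_ext with (CPSeries (kummer_coeff a c)).
  { intros y. symmetry. now apply kummerM_CPSeries. }
  replace (a / c * kummerM (a + 1) (c + 1) z)
    with (CPSeries (CPS_derive (kummer_coeff a c)) z).
  { now apply is_Cderive_CPSeries, entire_kummer_coeff. }
  rewrite kummerM_CPSeries by auto.
  apply is_Cseries_unique with (fun n => CPS_derive (kummer_coeff a c) n * z ^ n).
  - now apply CPSeries_is_series, entire_coeffs_derive, entire_kummer_coeff.
  - eapply is_Cseries_ext;
      [|apply is_Cseries_scal, CPSeries_is_series, entire_kummer_coeff, Hc1].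
    intros n. unfold CPS_derive. rewrite kummer_coeff_S by auto. simpl. ring.
Qed.

(** Together with [is_Cderive_kummerM], this expresses the derivatives of M(a, c) and M(a + 1, c +
    1) through these two functions alone. The relation stays multiplied by z so that it also makes
    sense at z = 0. *)
Lemma is_Cderive_kummerM_contiguous (a c z : C) : (0 < Re c)%R ->
  exists l : C, is_Cderive (kummerM (a + 1) (c + 1)) z l /\
    z * l = c * kummerM a c z + (z - c) * kummerM (a + 1) (c + 1) z.
Proof.
  intros Hc.
  assert (Hc1 : (0 < Re (c + 1))%R) by (unfold Re in *; simpl; lra).
  pose proof (pochhammer_neq_0 _ 1 Hc) as Hc0. simpl in Hc0.
  assert (Hcn : c <> 0) by (intros E; apply Hc0; rewrite E; ring).
  exists (CPSeries (CPS_derive (kummer_coeff (a + 1) (c + 1))) z). split.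
  { eapply is_Cderive_ext.
    - intros y. symmetry. apply kummerM_CPSeries, Hc1.
    - now apply is_Cderive_CPSeries, entire_kummer_coeff. }
  rewrite !kummerM_CPSeries by auto.
  pose proof (CPSeries_is_series _ z (entire_kummer_coeff a c Hc)) as U.
  pose proof (CPSeries_is_series _ z (entire_kummer_coeff (a + 1) _ Hc1)) as V.
  pose proof (CPSeries_is_series _ z
    (entire_coeffs_derive _ (entire_kummer_coeff (a + 1) _ Hc1))) as V'.
  (* Multiplication by z raises exponents by one; the shift realigns the series so that coefficients
     of equal powers can be compared. *)
  apply (is_Cseries_scal z), is_Cseries_shift in V'.
  refine (is_Cseries_unique _ _ _ V' _).
  pose proof (is_Cseries_scal z _ _ V) as zV. apply is_Cseries_shift in zV.
  apply (is_Cseries_scal c) in U. apply (is_Cseries_scal (- c)) in V.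
  pose proof (is_Cseries_plus _ _ _ _ (is_Cseries_plus _ _ _ _ U V) zV) as S.
  revert S. set (Uz := CPSeries (kummer_coeff a c) z).
  set (Vz := CPSeries (kummer_coeff (a + 1) (c + 1)) z).
  replace (c * Uz + - c * Vz + z * Vz) with (c * Uz + (z - c) * Vz) by ring.
  apply is_Cseries_ext. intros [|n].
  - unfold kummer_coeff; simpl. field.
  - unfold shift, CPS_derive.
    pose proof (pochhammer_neq_0 _ n Hc1) as Hp.
    pose proof (pochhammer_neq_0 _ (S n) Hc1) as Hp'. simpl in Hp'.
    assert (Hq : c + 1 + INR n <> 0) by (intros E; apply Hp'; rewrite E; ring).
    assert (Hn : RtoC (INR n) + 1 <> 0).
    { rewrite <- RtoC_plus. intros E. apply RtoC_inj in E. pose proof (pos_INR n). lra. }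
    unfold kummer_coeff. rewrite !(pochhammer_S_l a), !(pochhammer_S_l c).
    rewrite fact_simpl, mult_INR, RtoC_mult, S_INR, RtoC_plus. simpl pochhammer.
    simpl Cpow. field. auto using INR_fact_C_neq_0.
Qed.

(** * The complex exponential *)

Lemma Cexp_0 : Cexp 0 = 1.
Proof.
  unfold Cexp, Re, Im; simpl. rewrite exp_0, cos_0, sin_0. ring.
Qed.

Lemma Cexp_plus (z w : C) : Cexp (z + w) = Cexp z * Cexp w.
Proof.
  destruct z as [x y], w as [u v]. unfold Cexp, Re, Im; simpl.
  rewrite exp_plus, cos_plus, sin_plus.
  unfold Cplus, Cmult, Ci, RtoC; simpl. f_equal; ring.
Qed.

Lemma derivable_pt_lim_0_eps (f : R -> R) (l : R) (eps : posreal) :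
  derivable_pt_lim f 0 l ->
  exists d : posreal, forall h : R, (Rabs h < d)%R ->
    (Rabs (f h - f 0 - l * h) <= eps * Rabs h)%R.
Proof.
  intros H. destruct (H eps (cond_pos eps)) as [d Hd]. exists d. intros h Hh.
  destruct (Req_dec h 0) as [->|Hn].
  - replace (f 0 - f 0 - l * 0)%R with 0%R by ring. rewrite Rabs_R0. lra.
  - specialize (Hd h Hn Hh). rewrite Rplus_0_l in Hd.
    replace (f h - f 0 - l * h)%R with (((f h - f 0) / h - l) * h)%R by (field; auto).
    rewrite Rabs_mult. apply Rmult_le_compat_r; [apply Rabs_pos|lra].
Qed.

(** The real and imaginary parts of the remainder are rewritten through the first-order remainders
    of exp, cos and sin at 0. *)
Lemma is_Cderive_Cexp_0 : is_Cderive Cexp 0 1.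
Proof.
  apply is_Cderive_eps. intros eps.
  (* The real part contributes 3 m n and the imaginary part 5 m n, hence eps / 8. The bound 1 gives
     |1 + x| <= 2. *)
  assert (He : (0 < Rmin 1 (eps / 8))%R).
  { apply Rmin_pos; [lra|]. pose proof (cond_pos eps). lra. }
  set (e := mkposreal _ He).
  pose proof (Rmin_l 1 (eps / 8)) as He1. pose proof (Rmin_r 1 (eps / 8)) as He8.
  destruct (derivable_pt_lim_0_eps exp 1 e derivable_pt_lim_exp_0) as [d1 H1].
  destruct (derivable_pt_lim_0_eps sin 1 e derivable_pt_lim_sin_0) as [d2 H2].
  pose proof (derivable_pt_lim_cos 0) as Hc. rewrite sin_0, Ropp_0 in Hc.
  destruct (derivable_pt_lim_0_eps cos 0 e Hc) as [d3 H3].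
  change (pos e) with (Rmin 1 (eps / 8)) in *.
  set (m := Rmin 1 (eps / 8)) in *.
  (* With d <= m, the quadratic term n^2 is at most m n. *)
  pose (d := Rmin m (Rmin d1 (Rmin d2 d3))).
  assert (Hd : (0 < d)%R).
  { apply Rmin_pos; [exact He|]. repeat apply Rmin_pos; apply cond_pos. }
  exists (mkposreal d Hd). simpl. intros h Hh.
  replace (h - 0) with h in * by ring. rewrite Cexp_0.
  assert (Hd' : (d <= m /\ d <= d1 /\ d <= d2 /\ d <= d3)%R).
  { pose proof (Rmin_l m (Rmin d1 (Rmin d2 d3))).
    pose proof (Rmin_r m (Rmin d1 (Rmin d2 d3))).
    pose proof (Rmin_l d1 (Rmin d2 d3)). pose proof (Rmin_r d1 (Rmin d2 d3)).
    pose proof (Rmin_l d2 d3). pose proof (Rmin_r d2 d3). unfold d. lra. }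
  pose proof (Rmax_Cmod h) as Hm.
  pose proof (Rle_trans _ _ _ (Rmax_l _ _) Hm) as Hx.
  pose proof (Rle_trans _ _ _ (Rmax_r _ _) Hm) as Hy.
  destruct h as [x y]. simpl in Hx, Hy. set (n := Cmod (x, y)) in *.
  specialize (H1 x ltac:(lra)). specialize (H2 y ltac:(lra)). specialize (H3 y ltac:(lra)).
  rewrite exp_0 in H1. rewrite sin_0 in H2. rewrite cos_0 in H3.
  pose proof (Rabs_pos x) as Px. pose proof (Rabs_pos y) as Py.
  assert (HA : (Rabs (exp x - 1 - x) <= m * n)%R).
  { replace (exp x - 1 - x)%R with (exp x - 1 - 1 * x)%R by ring. nra. }
  assert (HB : (Rabs (cos y - 1) <= m * n)%R).
  { replace (cos y - 1)%R with (cos y - 1 - 0 * y)%R by ring. nra. }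
  assert (HD : (Rabs (sin y - y) <= m * n)%R).
  { replace (sin y - y)%R with (sin y - 0 - 1 * y)%R by ring. nra. }
  assert (HS : (Rabs (sin y) <= 2 * n)%R).
  { replace (sin y) with ((sin y - y) + y)%R by ring.
    eapply Rle_trans; [apply Rabs_triang|]. nra. }
  assert (HC : (Rabs (cos y) <= 1)%R) by (apply Rabs_le, COS_bound).
  eapply Rle_trans; [apply Cmod_le_components|].
  replace (Re (Cexp (x, y) - 1 - (x, y) * 1))
    with ((exp x - 1 - x) * cos y + (1 + x) * (cos y - 1))%R
    by (unfold Cexp, Re, Im; simpl; ring).
  replace (Im (Cexp (x, y) - 1 - (x, y) * 1))
    with ((exp x - 1 - x + x) * sin y + (sin y - y))%R
    by (unfold Cexp, Re, Im; simpl; ring).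
  assert (HR : (Rabs ((exp x - 1 - x) * cos y + (1 + x) * (cos y - 1)) <= 3 * (m * n))%R).
  { eapply Rle_trans; [apply Rabs_triang|]. rewrite !Rabs_mult.
    pose proof (Rabs_triang 1 x) as T. rewrite Rabs_R1 in T.
    pose proof (Rabs_pos (exp x - 1 - x)). pose proof (Rabs_pos (cos y - 1)).
    pose proof (Rabs_pos (cos y)). pose proof (Rabs_pos (1 + x)). nra. }
  assert (HI : (Rabs ((exp x - 1 - x + x) * sin y + (sin y - y)) <= 5 * (m * n))%R).
  { eapply Rle_trans; [apply Rabs_triang|]. rewrite Rabs_mult.
    pose proof (Rabs_triang (exp x - 1 - x) x) as T.
    assert (T2 : (Rabs (exp x - 1 - x + x) <= 2 * n)%R) by nra.
    assert (Rabs (exp x - 1 - x + x) * Rabs (sin y) <= (2 * n) * (2 * n))%R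
      by (apply Rmult_le_compat; auto using Rabs_pos).
    nra. }
  assert (0 <= n)%R by apply Cmod_ge_0. nra.
Qed.

(** The functional equation transports the derivative from 0 to z. *)
Lemma is_Cderive_Cexp (z : C) : is_Cderive Cexp z (Cexp z).
Proof.
  apply is_Cderive_ext with (fun y => Cexp z * Cexp (y - z)).
  { intros y. rewrite <- Cexp_plus. f_equal. ring. }
  eapply is_Cderive_eq.
  - apply (is_Cderive_mult (fun _ => Cexp z) (fun y => Cexp (y - z)));
      [apply is_Cderive_const|].
    apply (is_Cderive_comp Cexp (fun y => y - z)).
    + replace (z - z) with (RtoC 0) by ring. apply is_Cderive_Cexp_0.
    + apply is_Cderive_minus; [apply is_Cderive_id|apply is_Cderive_const].
  - ring.
Qed.

(** With [e3_opp_e7], this is all that is used about the two constants; the later identities treat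
    [e7] as an indeterminate. *)
Lemma e7_sqr : e7 * e7 = - Ci.
Proof.
  unfold e7. rewrite <- Cexp_plus. unfold Cexp, Re, Im; simpl.
  replace (7 * PI / 4 * 0 - 0 * 1 + (7 * PI / 4 * 0 - 0 * 1))%R with 0%R by ring.
  replace (7 * PI / 4 * 1 + 0 * 0 + (7 * PI / 4 * 1 + 0 * 0))%R
    with (3 * (PI / 2) + 2 * PI)%R by field.
  rewrite exp_0, cos_plus, sin_plus, cos_2PI, sin_2PI, cos_3PI2, sin_3PI2.
  unfold Cplus, Cmult, Copp, Ci, RtoC; simpl. f_equal; ring.
Qed.

Lemma e3_opp_e7 : e3 = - e7.
Proof.
  unfold e3, e7.
  replace (RtoC (7 * PI / 4) * Ci) with (RtoC (3 * PI / 4) * Ci + RtoC PI * Ci).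
  - rewrite Cexp_plus.
    replace (Cexp (RtoC PI * Ci)) with (- (1) : C); [ring|].
    unfold Cexp, Re, Im; simpl.
    replace (PI * 0 - 0 * 1)%R with 0%R by ring.
    replace (PI * 1 + 0 * 0)%R with PI by ring.
    rewrite exp_0, cos_PI, sin_PI.
    unfold Cplus, Cmult, Copp, Ci, RtoC; simpl. f_equal; ring.
  - rewrite <- Cmult_plus_distr_r, <- RtoC_plus. do 2 f_equal. field.
Qed.

(** * Meromorphic solutions and their Wronskian *)

Lemma is_Cderive_inv_comp (f : C -> C) (z df : C) : f z <> 0 ->
  is_Cderive f z df -> is_Cderive (fun y => / f y) z (df * - / (f z * f z)).
Proof.
  intros Hz Hf. apply (is_Cderive_comp Cinv f); auto. now apply is_Cderive_inv.
Qed.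

Lemma is_Cderive_div_const (f : C -> C) (k z df : C) :
  is_Cderive f z df -> is_Cderive (fun y => f y / k) z (df / k).
Proof.
  intros H. eapply is_Cderive_eq.
  - unfold Cdiv. apply is_Cderive_mult; [exact H|apply is_Cderive_const].
  - unfold Cdiv. ring.
Qed.

(** The derivative is built by unification. Hypotheses come first, so that known derivatives of
    compound functions are used whole. *)
Ltac Cder := repeat first
  [ eassumption
  | apply is_Cderive_const
  | apply is_Cderive_id
  | apply is_Cderive_minus
  | apply is_Cderive_plus
  | apply is_Cderive_div_const
  | apply is_Cderive_mult
  | apply is_Cderive_inv_comp ].

Lemma is_Cderive_pow2 (z : C) : is_Cderive (fun y => y ^ 2) z (2 * z).
Proof. eapply is_Cderive_eq; [simpl; Cder|cbv beta; ring]. Qed.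

Lemma kummerM_0 (a c : C) : (0 < Re c)%R -> kummerM a c 0 = 1.
Proof.
  intros Hc. rewrite kummerM_CPSeries by auto.
  pose proof (CPSeries_is_series _ 0 (entire_kummer_coeff a c Hc)) as H.
  refine (is_Cseries_unique _ _ _ H _).
  replace (RtoC 1) with
    (0 * CPSeries (kummer_coeff a c) 0 + kummer_coeff a c 0 * 0 ^ 0).
  - apply (is_Cseries_decr_1 (fun n => kummer_coeff a c n * 0 ^ n)).
    eapply is_Cseries_ext; [|apply is_Cseries_scal, H].
    intros n. simpl. ring.
  - unfold kummer_coeff. simpl. field.
Qed.

(** * The exceptional set *)

Lemma sqr_eq_cases (y s : C) : y ^ 2 = s ^ 2 -> y = s \/ y = - s.
Proof.
  intros H.
  assert (E : (y - s) * (y + s) = 0).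
  { replace ((y - s) * (y + s)) with (y ^ 2 - s ^ 2) by ring. rewrite H. ring. }
  destruct (Ceq_dec (y + s) 0) as [E1|E1].
  - right. replace y with (y + s - s) by ring. rewrite E1. ring.
  - left. destruct (Ceq_dec y s) as [|E2]; [assumption|exfalso].
    revert E. apply Cmult_neq_0; auto. now apply Cminus_eq_contra.
Qed.

Lemma not_A_neq_0 (tau z : C) : ~ A tau z -> tau - z ^ 2 <> 0.
Proof.
  intros Hz E. apply Hz. unfold A. replace tau with (tau - z ^ 2 + z ^ 2) by ring.
  rewrite E. ring.
Qed.

Lemma not_A_locally (tau z : C) :
  ~ A tau z -> @locally C_UniformSpace z (fun y => ~ A tau y).
Proof.
  intros Hz.
  pose proof (not_A_neq_0 _ _ Hz) as H0.
  apply Cmod_gt_0 in H0.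
  eapply filter_imp; [|exact (is_Cderive_continuous _ _ _ (mkposreal _ H0)
    (is_Cderive_pow2 z))].
  intros y Hy Ay. cbn [pos] in Hy. unfold A in Ay. rewrite Ay in Hy. lra.
Qed.

(** Off the set, its complement is open. At a root p the only other root is -p, at distance |2
    p|. *)
Lemma A_isolated (tau p : C) : @locally' C_UniformSpace p (fun z => ~ A tau z).
Proof.
  unfold locally', within.
  destruct (classic (A tau p)) as [Hp|Hp].
  2: { generalize (not_A_locally tau p Hp). apply filter_imp. auto. }
  unfold A in *.
  assert (F : forall y, y <> p -> y ^ 2 = tau -> y = - p).
  { intros y Hn Hy. destruct (sqr_eq_cases y p) as [|]; congruence. }
  apply locally_Cmod.
  destruct (Ceq_dec p 0) as [E0|E0].
  - exists (mkposreal 1 Rlt_0_1). intros y _ Hn Hy. apply Hn.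
    rewrite (F y Hn Hy), E0. change (@eq C (- 0) 0). ring.
  - assert (H2 : (0 < Cmod (2 * p))%R).
    { apply Cmod_gt_0, Cmult_neq_0; auto. intros E. apply RtoC_inj in E. lra. }
    exists (mkposreal _ H2). simpl. intros y Hd Hn Hy.
    rewrite (F y Hn Hy) in Hd.
    replace (- p - p) with (- (2 * p)) in Hd by ring. rewrite Cmod_opp in Hd. lra.
Qed.

(** * Quotients by powers of [tau - z ^ 2] *)

Lemma is_Cderive_quotient (tau : C) (N : C -> C) (z n : C) :
  ~ A tau z -> is_Cderive N z n ->
  is_Cderive (fun y => N y / (tau - y ^ 2) ^ 2) z
    (n / (tau - z ^ 2) ^ 2 + 4 * z * N z / (tau - z ^ 2) ^ 3).
Proof.
  intros Hz HN. pose proof (not_A_neq_0 _ _ Hz) as H0.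
  pose proof (is_Cderive_pow2 z).
  eapply is_Cderive_eq.
  - unfold Cdiv. apply is_Cderive_mult; [eassumption|].
    apply (is_Cderive_inv_comp (fun y => (tau - y ^ 2) ^ 2)).
    + now apply Cpow_nz.
    + apply (is_Cderive_comp (fun y => y ^ 2) (fun y => tau - y ^ 2)).
      * apply is_Cderive_pow2.
      * Cder.
  - cbv beta. field. exact H0.
Qed.

Lemma is_Cderive_quotient_derive (tau : C) (N N' : C -> C) (z n : C) :
  ~ A tau z -> is_Cderive N z (N' z) -> is_Cderive N' z n ->
  is_Cderive (fun y => N' y / (tau - y ^ 2) ^ 2 + 4 * y * N y / (tau - y ^ 2) ^ 3) z
    (n / (tau - z ^ 2) ^ 2 + (8 * z * N' z + 4 * N z) / (tau - z ^ 2) ^ 3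
     + 24 * z ^ 2 * N z / (tau - z ^ 2) ^ 4).
Proof.
  intros Hz HN HN'. pose proof (not_A_neq_0 _ _ Hz) as H0.
  pose proof (is_Cderive_pow2 z) as Hp.
  eapply is_Cderive_eq.
  - apply is_Cderive_plus; [apply is_Cderive_quotient; [exact Hz|exact HN']|].
    unfold Cdiv. apply is_Cderive_mult.
    + apply is_Cderive_mult; [Cder|exact HN].
    + apply (is_Cderive_inv_comp (fun y => (tau - y ^ 2) ^ 3)).
      * now apply Cpow_nz.
      * eapply is_Cderive_ext with (fun y => (tau - y ^ 2) * (tau - y ^ 2) * (tau - y ^ 2)).
        { intros y. ring. }
        Cder.
  - cbv beta. field. exact H0.
Qed.

Section Quotient.
Variables (tau : C) (N N' N'' X : C -> C).
Hypothesis HN : forall z, is_Cderive N z (N' z).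
Hypothesis HN' : forall z, is_Cderive N' z (N'' z).
Hypothesis HX : forall z, ~ A tau z -> X z = N z / (tau - z ^ 2) ^ 2.

Lemma is_Cderive_pole2 (z : C) : ~ A tau z ->
  is_Cderive X z (N' z / (tau - z ^ 2) ^ 2 + 4 * z * N z / (tau - z ^ 2) ^ 3).
Proof.
  intros Hz. eapply is_Cderive_ext_loc; [|now apply is_Cderive_quotient].
  generalize (not_A_locally tau z Hz). apply filter_imp.
  intros y Hy. symmetry. now apply HX.
Qed.

(* [Ci ((tau - z^2) N'' + 2 z N' - 2 N) + (tau - z^2)^2 N = 0] is the equation
   satisfied by the numerator [N = (tau - z^2)^2 X]. *)
Lemma is_solution_pole2 :
  (forall z, Ci * ((tau - z ^ 2) * N'' z + 2 * z * N' z - 2 * N z)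
     + (tau - z ^ 2) ^ 2 * N z = 0) ->
  is_solution tau X.
Proof.
  intros HE z Hz.
  pose proof (is_Cderive_pole2 z Hz) as H1.
  assert (H2 : is_Cderive (C_derive X) z
    (N'' z / (tau - z ^ 2) ^ 2 + (8 * z * N' z + 4 * N z) / (tau - z ^ 2) ^ 3
     + 24 * z ^ 2 * N z / (tau - z ^ 2) ^ 4)).
  { eapply is_Cderive_ext_loc; [|now apply (is_Cderive_quotient_derive tau N N')].
    generalize (not_A_locally tau z Hz). apply filter_imp.
    intros y Hy. symmetry. now apply C_derive_eq, is_Cderive_pole2. }
  split; [eapply is_Cderive_Cdifferentiable, H1|].
  split; [eapply is_Cderive_Cdifferentiable, H2|].
  rewrite (C_derive_eq _ _ _ H1), (C_derive_eq _ _ _ H2), HX by auto.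
  pose proof (not_A_neq_0 _ _ Hz) as H0.
  transitivity ((Ci * ((tau - z ^ 2) * N'' z + 2 * z * N' z - 2 * N z)
     + (tau - z ^ 2) ^ 2 * N z) / (tau - z ^ 2) ^ 2).
  - field. exact H0.
  - rewrite HE. field. exact H0.
Qed.

Lemma meromorphic_off_pole2 : meromorphic_off (A tau) X.
Proof.
  split; [apply A_isolated|]. split.
  { intros z Hz. eapply is_Cderive_Cdifferentiable. now apply is_Cderive_pole2. }
  intros p Hp. pose proof (A_isolated tau p) as Hi. unfold locally', within in *.
  unfold A in Hp.
  destruct (Ceq_dec p 0) as [E|E].
  (* Here tau = 0 and the denominator is z^4. *)
  - exists 4%nat, N. split.
    + apply locally_Cmod. exists (mkposreal 1 Rlt_0_1). intros y _.
      eapply is_Cderive_Cdifferentiable, HN.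
    + revert Hi. apply filter_imp. intros y Hy Hn. specialize (Hy Hn).
      rewrite HX by exact Hy. pose proof (not_A_neq_0 _ _ Hy) as H0.
      rewrite E in *. replace tau with (RtoC 0) in * by (rewrite <- Hp; ring).
      field. intros E'. apply H0. rewrite E'. ring.
  (* The denominator is (z - p)^2 (z + p)^2, and z + p does not vanish within distance |2 p| of
     p. *)
  - exists 2%nat, (fun z => N z / (z + p) ^ 2).
    assert (Hd : @locally C_UniformSpace p (fun z => z + p <> 0)).
    { assert (H2 : (0 < Cmod (2 * p))%R).
      { apply Cmod_gt_0, Cmult_neq_0; auto. intros E'. apply RtoC_inj in E'. lra. }
      apply locally_Cmod. exists (mkposreal _ H2). intros y Hy E'. cbn [pos] in Hy.
      replace (y - p) with (y + p - 2 * p) in Hy by ring. rewrite E' in Hy.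
      replace (0 - 2 * p) with (- (2 * p)) in Hy by ring. rewrite Cmod_opp in Hy. lra. }
    split.
    + revert Hd. apply filter_imp. intros z Hz.
      eapply is_Cderive_Cdifferentiable. unfold Cdiv.
      apply is_Cderive_mult; [apply HN|].
      apply (is_Cderive_inv_comp (fun z => (z + p) ^ 2)); [now apply Cpow_nz|].
      apply (is_Cderive_comp (fun y => y ^ 2) (fun y => y + p)).
      * apply is_Cderive_pow2.
      * Cder.
    + generalize (filter_and _ _ Hd Hi). apply filter_imp.
      intros y [H1 H2] Hn. specialize (H2 Hn).
      rewrite HX by exact H2. pose proof (not_A_neq_0 _ _ H2) as H0.
      rewrite <- Hp in *.
      field. split; [exact H1|].
      intros E'. apply H0. rewrite E'. ring.
Qed.
End Quotient.

(** By Abel's identity the Wronskian satisfies W' = 6 z W / (tau - z^2), as does (tau - z^2)^(-3);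
    the cube makes the product constant. *)
Definition scaled_wronskian (tau : C) (Y Z : C -> C) (z : C) : C :=
  (tau - z ^ 2) ^ 3 * (Y z * C_derive Z z - C_derive Y z * Z z).

Lemma Ci_neq_0 : Ci <> 0.
Proof. intros E. apply (f_equal Im) in E. unfold Im in E; simpl in E. lra. Qed.

Lemma is_Cderive_scaled_wronskian (tau : C) (Y Z : C -> C) (z : C) :
  is_solution tau Y -> is_solution tau Z -> ~ A tau z ->
  is_Cderive (scaled_wronskian tau Y Z) z 0.
Proof.
  intros HY HZ Hz.
  destruct (HY z Hz) as [Y1 [Y2 EY]]. destruct (HZ z Hz) as [Z1 [Z2 EZ]].
  apply C_derive_is_Cderive in Y1, Y2, Z1, Z2.
  pose proof (is_Cderive_pow2 z) as Hp.
  pose proof (not_A_neq_0 _ _ Hz) as H0.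
  eapply is_Cderive_eq.
  - unfold scaled_wronskian. apply is_Cderive_mult.
    + eapply is_Cderive_ext with (fun y => (tau - y ^ 2) * (tau - y ^ 2) * (tau - y ^ 2)).
      { intros y. ring. }
      Cder.
    + Cder.
  - cbv beta.
    set (a := Y z) in *. set (a1 := C_derive Y z) in *.
    set (a2 := C_derive (C_derive Y) z) in *.
    set (b := Z z) in *. set (b1 := C_derive Z z) in *.
    set (b2 := C_derive (C_derive Z) z) in *. set (D := tau - z ^ 2) in *.
    (* The derivative is D^2 / i times a combination of the two equations in which the zeroth-order
       terms cancel. *)
    transitivity (D ^ 2 / Ci * (a * (Ci * D * b2 - 6 * Ci * z * b1 + (D ^ 2 - 6 * Ci) * b)
      - b * (Ci * D * a2 - 6 * Ci * z * a1 + (D ^ 2 - 6 * Ci) * a))).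
    + field. exact Ci_neq_0.
    + rewrite EY, EZ. ring.
Qed.

Lemma scaled_wronskian_const (tau : C) (Y Z : C -> C) :
  is_solution tau Y -> is_solution tau Z ->
  exists k : C, forall z, ~ A tau z -> scaled_wronskian tau Y Z z = k.
Proof.
  intros HY HZ.
  (* The constant is the value at a chosen point p; without any such point the claim is vacuous. *)
  destruct (classic (exists p, ~ A tau p)) as [[p Hp]|H].
  2: { exists 0. intros z Hz. exfalso. eauto. }
  exists (scaled_wronskian tau Y Z p). intros z Hz.
  (* The case split takes the place of constructing a square root of tau: given a root s, the
     punctures are s and -s; given none, every segment is admissible. *)
  destruct (classic (exists s, A tau s)) as [[s Hs]|H].
  - assert (F : forall y, ~ A tau y -> y <> s /\ y <> - s).
    { intros y Hy. split; intros ->; apply Hy; auto. unfold A in *.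
      rewrite <- Hs. ring. }
    assert (G : forall y, y <> s -> y <> - s -> ~ A tau y).
    { intros y H1 H2 Hy. unfold A in *. destruct (sqr_eq_cases y s) as [|]; congruence. }
    apply (zero_Cderive_const _ s (- s)); try (now apply F).
    intros y H1 H2. apply is_Cderive_scaled_wronskian; auto.
  - apply zero_Cderive_segment. intros t _. apply is_Cderive_scaled_wronskian; eauto.
Qed.

(** * The numerators of the two solutions *)

Lemma is_Cderive_kummerM_sqr (a c h z : C) : (0 < Re c)%R ->
  is_Cderive (fun y => kummerM a c (h * y ^ 2)) z
    (2 * h * z * (a / c * kummerM (a + 1) (c + 1) (h * z ^ 2))).
Proof.
  intros Hc. pose proof (is_Cderive_pow2 z).
  eapply is_Cderive_eq.
  - apply (is_Cderive_comp (kummerM a c) (fun y => h * y ^ 2)).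
    + now apply is_Cderive_kummerM.
    + Cder.
  - cbv beta. ring.
Qed.

(** Multiplying by z turns the chain-rule factor 2 h z into 2 (h z^2), as the contiguous relation
    requires. *)
Lemma is_Cderive_kummerM_sqr_contiguous (a c h z : C) : (0 < Re c)%R ->
  exists l : C, is_Cderive (fun y => kummerM (a + 1) (c + 1) (h * y ^ 2)) z l /\
    z * l = 2 * (c * kummerM a c (h * z ^ 2)
                 + (h * z ^ 2 - c) * kummerM (a + 1) (c + 1) (h * z ^ 2)).
Proof.
  intros Hc. destruct (is_Cderive_kummerM_contiguous a c (h * z ^ 2) Hc) as [l [H1 H2]].
  pose proof (is_Cderive_pow2 z).
  exists (2 * h * z * l). split.
  - eapply is_Cderive_eq.
    + apply (is_Cderive_comp (kummerM (a + 1) (c + 1)) (fun y => h * y ^ 2));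
        [exact H1|Cder].
    + cbv beta. ring.
  - rewrite <- H2. ring.
Qed.

Lemma Re_half_pos : (0 < Re (1 / 2))%R /\ (0 < Re (3 / 2))%R.
Proof. rewrite <- !RtoC_div by lra. unfold Re; simpl. split; lra. Qed.

Section Numerators.
Variable tau : C.
Notation Ma z := (kummerM (a_ tau) (1 / 2) (e7 * z ^ 2)).
Notation Mb z := (kummerM (b_ tau) (3 / 2) (e7 * z ^ 2)).
Notation Mc z := (kummerM (c_ tau) (3 / 2) (e7 * z ^ 2)).
Notation Md z := (kummerM (d_ tau) (5 / 2) (e7 * z ^ 2)).
Notation E z := (Cexp (1 / 2 * e3 * z ^ 2)).

(** Since [b_ = a_ + 1] and [d_ = c_ + 1], the pairs (Ma, Mb) and (Mc, Md) are contiguous. *)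
Lemma is_Cderive_Ma (z : C) : is_Cderive (fun y => Ma y) z (4 * a_ tau * e7 * z * Mb z).
Proof.
  eapply is_Cderive_eq; [apply is_Cderive_kummerM_sqr, Re_half_pos|].
  replace (a_ tau + 1) with (b_ tau) by (unfold a_, b_; field).
  replace (1 / 2 + 1) with (3 / 2 : C) by field. field.
Qed.

Lemma is_Cderive_Mb (z : C) : exists q, is_Cderive (fun y => Mb y) z q /\
  z * q = Ma z + (2 * e7 * z ^ 2 - 1) * Mb z.
Proof.
  destruct (is_Cderive_kummerM_sqr_contiguous (a_ tau) (1 / 2) e7 z (proj1 Re_half_pos))
    as [q H]. exists q.
  replace (a_ tau + 1) with (b_ tau) in H by (unfold a_, b_; field).
  replace (1 / 2 + 1) with (3 / 2 : C) in H by field.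
  destruct H as [H1 H2]. split; auto. rewrite H2. field.
Qed.

Lemma is_Cderive_Mc (z : C) : is_Cderive (fun y => Mc y) z (4 / 3 * c_ tau * e7 * z * Md z).
Proof.
  eapply is_Cderive_eq; [apply is_Cderive_kummerM_sqr, Re_half_pos|].
  replace (c_ tau + 1) with (d_ tau) by (unfold c_, d_; field).
  replace (3 / 2 + 1) with (5 / 2 : C) by field. field.
Qed.

Lemma is_Cderive_Md (z : C) : exists q, is_Cderive (fun y => Md y) z q /\
  z * q = 3 * Mc z + (2 * e7 * z ^ 2 - 3) * Md z.
Proof.
  destruct (is_Cderive_kummerM_sqr_contiguous (c_ tau) (3 / 2) e7 z (proj2 Re_half_pos))
    as [q H]. exists q.
  replace (c_ tau + 1) with (d_ tau) in H by (unfold c_, d_; field).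
  replace (3 / 2 + 1) with (5 / 2 : C) in H by field.
  destruct H as [H1 H2]. split; auto. rewrite H2. field.
Qed.

Lemma is_Cderive_E (z : C) : is_Cderive (fun y => E y) z (- e7 * z * E z).
Proof.
  pose proof (is_Cderive_pow2 z).
  eapply is_Cderive_eq.
  - apply (is_Cderive_comp Cexp (fun y => 1 / 2 * e3 * y ^ 2));
      [apply is_Cderive_Cexp|Cder].
  - cbv beta. rewrite e3_opp_e7. field.
Qed.

(** [N1] is the image of w = E Ma under w -> (tau - z^2) w - z w' / e7. The image of w = z E Mc is
    -4 [c_] / e7 times [N2]; dropping that factor keeps [N2] nonzero when [c_] = 0. *)
Definition N1 (z : C) : C := E z * (tau * Ma z - 4 * a_ tau * z ^ 2 * Mb z).
Definition N1' (z : C) : C :=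
  E z * (z * Ma z + 4 * a_ tau * z * (tau * e7 - 1 - e7 * z ^ 2) * Mb z).
Definition N2 (z : C) : C := z * E z * (Mc z + e7 * (z ^ 2 / 3) * Md z).
Definition N2' (z : C) : C :=
  E z * (Mc z + e7 * (z ^ 2 / 3) * (4 * c_ tau + e7 * z ^ 2) * Md z).

(** The first summand comes from E' = -e7 z E, the second from the derivative of the bracket after
    the contiguous relation has removed Mb'. [N2''] has the same shape. *)
Definition N1'' (z : C) : C :=
  - e7 * z * N1' z
  + E z * ((1 + 4 * a_ tau * (tau * e7 - 1 - e7 * z ^ 2)) * Ma z
    + 4 * a_ tau * (- e7 * z ^ 2 + 2 * e7 * z ^ 2 * (tau * e7 - 1 - e7 * z ^ 2)) * Mb z).
Definition N2'' (z : C) : C :=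
  - e7 * z * N2' z
  + E z * (e7 * z * (4 * c_ tau + e7 * z ^ 2) * Mc z
    + e7 / 3 * z * (4 * c_ tau + 8 * c_ tau + 4 * e7 * z ^ 2
       + (4 * c_ tau + e7 * z ^ 2) * (2 * e7 * z ^ 2 - 3)) * Md z).

Lemma is_Cderive_N1 (z : C) : is_Cderive N1 z (N1' z).
Proof.
  pose proof (is_Cderive_pow2 z). pose proof (is_Cderive_Ma z).
  pose proof (is_Cderive_E z). destruct (is_Cderive_Mb z) as [q [Hq Eq]].
  eapply is_Cderive_eq; [unfold N1; Cder|].
  cbv beta. unfold N1'.
  (* Only the product z q is known, so it is isolated before rewriting. Then 4 [a_] = -1 - tau e7
     reduces the coefficient of Ma to z. *)
  transitivity (E z * (- e7 * z * (tau * Ma z - 4 * a_ tau * z ^ 2 * Mb z)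
    + 4 * a_ tau * (tau * e7 * z * Mb z - 2 * z * Mb z - z * (z * q)))); [ring|].
  rewrite Eq. unfold a_. field.
Qed.

Lemma is_Cderive_N1' (z : C) : is_Cderive N1' z (N1'' z).
Proof.
  pose proof (is_Cderive_pow2 z). pose proof (is_Cderive_Ma z).
  pose proof (is_Cderive_E z). destruct (is_Cderive_Mb z) as [q [Hq Eq]].
  eapply is_Cderive_eq; [unfold N1'; Cder|].
  cbv beta. unfold N1'', N1'.
  set (k := tau * e7 - 1 - e7 * z ^ 2).
  transitivity (- e7 * z * (E z * (z * Ma z + 4 * a_ tau * z * k * Mb z))
    + E z * (Ma z + 4 * a_ tau * e7 * z ^ 2 * Mb z + 4 * a_ tau * k * Mb z
       - 8 * a_ tau * e7 * z ^ 2 * Mb z + 4 * a_ tau * k * (z * q))).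
  - ring.
  - rewrite Eq. ring.
Qed.

Lemma is_Cderive_N2 (z : C) : is_Cderive N2 z (N2' z).
Proof.
  pose proof (is_Cderive_pow2 z). pose proof (is_Cderive_Mc z).
  pose proof (is_Cderive_E z). destruct (is_Cderive_Md z) as [q [Hq Eq]].
  eapply is_Cderive_eq; [unfold N2; Cder|].
  cbv beta. unfold N2'.
  transitivity (E z * ((1 - e7 * z ^ 2) * (Mc z + e7 * (z ^ 2 / 3) * Md z)
    + z * (4 / 3 * c_ tau * e7 * z * Md z + e7 / 3 * (2 * z * Md z + z * (z * q)))));
    [field|].
  rewrite Eq. field.
Qed.

Lemma is_Cderive_N2' (z : C) : is_Cderive N2' z (N2'' z).
Proof.
  pose proof (is_Cderive_pow2 z). pose proof (is_Cderive_Mc z).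
  pose proof (is_Cderive_E z). destruct (is_Cderive_Md z) as [q [Hq Eq]].
  eapply is_Cderive_eq; [unfold N2'; Cder|].
  cbv beta. unfold N2'', N2'.
  transitivity (- e7 * z * (E z * (Mc z + e7 * (z ^ 2 / 3) * (4 * c_ tau + e7 * z ^ 2) * Md z))
    + E z * (4 / 3 * c_ tau * e7 * z * Md z
       + e7 / 3 * (8 * c_ tau * z + 4 * e7 * z ^ 3) * Md z
       + e7 / 3 * z * (4 * c_ tau + e7 * z ^ 2) * (z * q))).
  - field.
  - rewrite Eq. field.
Qed.

(** Since -e7^2 = i and i^2 = -1, the equation becomes an identity in tau, z and e7 without i. *)
Lemma numerator_equation (z n n' n'' : C) :
  (tau - z ^ 2) * n'' + 2 * z * n' - 2 * n = - (e7 * e7) * (tau - z ^ 2) ^ 2 * n ->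
  Ci * ((tau - z ^ 2) * n'' + 2 * z * n' - 2 * n) + (tau - z ^ 2) ^ 2 * n = 0.
Proof.
  intros ->. rewrite e7_sqr.
  transitivity ((Ci * Ci + 1) * ((tau - z ^ 2) ^ 2 * n)); [ring|].
  replace (Ci * Ci + 1) with (RtoC 0); [ring|].
  unfold Ci, Cmult, Cplus, RtoC; simpl. f_equal; ring.
Qed.

Lemma N1_equation (z : C) :
  Ci * ((tau - z ^ 2) * N1'' z + 2 * z * N1' z - 2 * N1 z) + (tau - z ^ 2) ^ 2 * N1 z = 0.
Proof.
  apply numerator_equation. unfold N1'', N1', N1.
  (* The coefficients of Ma and Mb agree separately, so the function values can be treated as
     indeterminates. *)
  generalize (Ma z) (Mb z) (E z). intros p q e. unfold a_. field.
Qed.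

Lemma N2_equation (z : C) :
  Ci * ((tau - z ^ 2) * N2'' z + 2 * z * N2' z - 2 * N2 z) + (tau - z ^ 2) ^ 2 * N2 z = 0.
Proof.
  apply numerator_equation. unfold N2'', N2', N2.
  generalize (Mc z) (Md z) (E z). intros p q e. unfold c_. field.
Qed.

(* [kummer_wronskian] is [f g' - f' g] for the even solution [f = Ma] and the odd
   solution [g z = z Mc z] of [f'' = 2 e7 z f' + 4 a_ e7 f]. *)
Definition kummer_wronskian (z : C) : C :=
  Ma z * (Mc z + 4 / 3 * c_ tau * e7 * z ^ 2 * Md z) - 4 * a_ tau * e7 * z ^ 2 * (Mb z * Mc z).

(** Abel's identity gives W' = 2 e7 z W, while (E^2)' = -2 e7 z E^2. The product is therefore
    constant, and it is 1 at the origin. *)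
Lemma kummer_wronskian_E (z : C) : kummer_wronskian z * (E z * E z) = 1.
Proof.
  transitivity (kummer_wronskian 0 * (E 0 * E 0)).
  - symmetry. apply (zero_Cderive_segment (fun y => kummer_wronskian y * (E y * E y))).
    intros t _. set (y := 0 + t * (z - 0)). clearbody y.
    pose proof (is_Cderive_pow2 y). pose proof (is_Cderive_Ma y).
    pose proof (is_Cderive_Mc y). pose proof (is_Cderive_E y).
    destruct (is_Cderive_Md y) as [s [Hs Es]]. destruct (is_Cderive_Mb y) as [q [Hq Eq]].
    eapply is_Cderive_eq; [unfold kummer_wronskian; Cder|].
    cbv beta. unfold kummer_wronskian.
    transitivity (E y * E y * ((4 * a_ tau * e7 * y * Mb y)
        * (Mc y + 4 / 3 * c_ tau * e7 * y ^ 2 * Md y)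
      + Ma y * (4 / 3 * c_ tau * e7 * y * (3 * Md y + y * s))
      - 4 * a_ tau * e7 * y * ((2 * Mb y + y * q) * Mc y
          + y * (Mb y * (4 / 3 * c_ tau * e7 * y * Md y)))
      - 2 * e7 * y * (Ma y * (Mc y + 4 / 3 * c_ tau * e7 * y ^ 2 * Md y)
          - 4 * a_ tau * e7 * y ^ 2 * (Mb y * Mc y)))).
    + field.
    (* The relation [c_ = a_ + 1/2], by which the even and odd functions solve the same equation,
       enters through the unfolding. *)
    + rewrite Eq, Es. generalize (Ma y) (Mb y) (Mc y) (Md y) (E y). intros.
      unfold a_, c_. field.
  - unfold kummer_wronskian. replace (e7 * 0 ^ 2) with (RtoC 0) by ring.
    rewrite !kummerM_0 by apply Re_half_pos.
    replace (1 / 2 * e3 * 0 ^ 2) with (RtoC 0) by ring. rewrite Cexp_0. ring.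
Qed.

(** Algebra reduces the left side to (tau - z^2) W E^2; the Mb Md terms cancel because 4 [c_] = 1 -
    tau e7. *)
Lemma numerator_wronskian (z : C) : N1 z * N2' z - N1' z * N2 z = tau - z ^ 2.
Proof.
  transitivity ((tau - z ^ 2) * (kummer_wronskian z * (E z * E z))).
  - unfold N1, N1', N2, N2', kummer_wronskian, a_, c_.
    generalize (Ma z) (Mb z) (Mc z) (Md z) (E z). intros p q r s e. field.
  - rewrite kummer_wronskian_E. ring.
Qed.
End Numerators.

(** * The fundamental system and the general solution *)

Lemma X1_numerator (tau z : C) : X1 tau z = N1 tau z / (tau - z ^ 2) ^ 2.
Proof. unfold X1, N1, Cdiv. ring. Qed.

Lemma X2_numerator (tau z : C) : X2 tau z = N2 tau z / (tau - z ^ 2) ^ 2.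
Proof. unfold X2, N2, Cdiv. ring. Qed.

(** The numerator equation is linear, so combinations of [N1] and [N2] solve it. The coefficients
    (1, 0) and (0, 1) give [X1] and [X2] themselves. *)
Lemma is_solution_combination (tau c1 c2 : C) (X : C -> C) :
  (forall z, ~ A tau z -> X z = c1 * X1 tau z + c2 * X2 tau z) -> is_solution tau X.
Proof.
  intros H.
  apply (is_solution_pole2 tau (fun z => c1 * N1 tau z + c2 * N2 tau z)
    (fun z => c1 * N1' tau z + c2 * N2' tau z)
    (fun z => c1 * N1'' tau z + c2 * N2'' tau z)).
  - intros z. pose proof (is_Cderive_N1 tau z). pose proof (is_Cderive_N2 tau z).
    eapply is_Cderive_eq; [Cder|cbv beta; ring].
  - intros z. pose proof (is_Cderive_N1' tau z). pose proof (is_Cderive_N2' tau z).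
    eapply is_Cderive_eq; [Cder|cbv beta; ring].
  - intros z Hz. rewrite H, X1_numerator, X2_numerator by exact Hz. unfold Cdiv. ring.
  - intros z.
    transitivity (
      c1 * (Ci * ((tau - z ^ 2) * N1'' tau z + 2 * z * N1' tau z - 2 * N1 tau z)
        + (tau - z ^ 2) ^ 2 * N1 tau z)
      + c2 * (Ci * ((tau - z ^ 2) * N2'' tau z + 2 * z * N2' tau z - 2 * N2 tau z)
        + (tau - z ^ 2) ^ 2 * N2 tau z)); [ring|].
    rewrite N1_equation, N2_equation. ring.
Qed.

(** Dividing both functions by (tau - z^2)^2 divides their Wronskian by (tau - z^2)^4, and the
    Wronskian of the numerators is tau - z^2. *)
Lemma scaled_wronskian_X1_X2 (tau z : C) : ~ A tau z ->
  scaled_wronskian tau (X1 tau) (X2 tau) z = 1.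
Proof.
  intros Hz. unfold scaled_wronskian.
  rewrite (C_derive_eq _ _ _ (is_Cderive_pole2 tau (N1 tau) (N1' tau) (X1 tau)
    (is_Cderive_N1 tau) (fun z _ => X1_numerator tau z) z Hz)).
  rewrite (C_derive_eq _ _ _ (is_Cderive_pole2 tau (N2 tau) (N2' tau) (X2 tau)
    (is_Cderive_N2 tau) (fun z _ => X2_numerator tau z) z Hz)).
  rewrite X1_numerator, X2_numerator.
  pose proof (not_A_neq_0 _ _ Hz) as H0.
  transitivity ((N1 tau z * N2' tau z - N1' tau z * N2 tau z) / (tau - z ^ 2)).
  - field. exact H0.
  - rewrite numerator_wronskian. field. exact H0.
Qed.

Theorem theorem1p1 (tau : C) :
  meromorphic_off (A tau) (X1 tau) /\
  meromorphic_off (A tau) (X2 tau) /\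
  forall X : C -> C,
    is_solution tau X <->
    exists c1 c2 : C, forall z : C, ~ A tau z ->
      X z = c1 * X1 tau z + c2 * X2 tau z.
Proof.
  split; [|split].
  - apply (meromorphic_off_pole2 tau (N1 tau) (N1' tau));
      auto using is_Cderive_N1, X1_numerator.
  - apply (meromorphic_off_pole2 tau (N2 tau) (N2' tau));
      auto using is_Cderive_N2, X2_numerator.
  - intros X. split; [|intros [c1 [c2 H]]; exact (is_solution_combination tau c1 c2 X H)].
    intros HX.
    assert (S1 : is_solution tau (X1 tau)).
    { apply (is_solution_combination tau 1 0). intros z _. ring. }
    assert (S2 : is_solution tau (X2 tau)).
    { apply (is_solution_combination tau 0 1). intros z _. ring. }
    (* The determinant of [X1] and [X2] is 1, so the two constants are already the coefficients
       sought. *)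
    destruct (scaled_wronskian_const tau X (X2 tau) HX S2) as [c1 H1].
    destruct (scaled_wronskian_const tau (X1 tau) X S1 HX) as [c2 H2].
    exists c1, c2. intros z Hz.
    rewrite <- (H1 z Hz), <- (H2 z Hz).
    (* Cramer's rule: [W(X, X2) X1 + W(X1, X) X2 = W(X1, X2) X]. *)
    transitivity (scaled_wronskian tau (X1 tau) (X2 tau) z * X z).
    + rewrite scaled_wronskian_X1_X2 by exact Hz. ring.
    + unfold scaled_wronskian. ring.
Qed.
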